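(* Let $n\ge 2$ and consider a chain of $n$ spin-$1/2$'s (Hilbert space $(\mathbb{C}^2)^{\otimes n}$, dimension $d=2^n$) with periodic boundary conditions (site indices taken modulo $n$). Let $$H=\sum_{i=1}^n H_i,\qquad H_i:=H'_i+H'_{i,i+1},$$ where each $H'_i$ is a real linear combination of $\sigma^x_i,\sigma^y_i,\sigma^z_i$, and each $H'_{i,i+1}$ is a real linear combination of $\sigma^a_i\sigma^b_{i+1}$ ($a,b\in\{x,y,z\}$); in particular $\operatorname{tr}H'_i=\operatorname{tr}H'_{i,i+1}=0$ and $\operatorname{tr}(H_iH_{i'})=0$ for $i\neq i'$. Assume $H$ is translationally invariant ($H_{i+1}=TH_iT^{-1}$ for all $i$, with $T$ the cyclic translation by one site) and $\|H_i\|=1$ for all $i$. Let $\{|j\rangle\}_{j=1}^d$ be a complete orthonormal set of translationally invariant eigenstates of $H$. Let $A$ consist of spins $1,\ldots,m$ and $B$ of the rest, with $m$ even and $f:=m/n\le 1/2$, and let $\rho_{j,A}:=\operatorname{tr}_B|j\rangle\langle j|$. Then $$\bar S:=\frac{1}{d}\sum_{j=1}^d S(\rho_{j,A})\le m\ln 2-\frac{f\langle H_1^2\rangle}{4},$$ where $\langle X\rangle:=d^{-1}\operatorname{tr}X$.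
   Context: $S(\rho)=-\operatorname{tr}(\rho\ln\rho)$ is the von Neumann entropy (natural logarithm); $\|\cdot\|$ is the operator norm; $\langle X\rangle=2^{-n}\operatorname{tr}X$ is the infinite-temperature expectation value. *)

(* Defs.v *)
From HB Require Import structures.
From mathcomp Require Import all_boot all_order all_algebra.
From mathcomp Require Import classical_sets reals exp.
From mathcomp Require Import complex.
Set Implicit Arguments. Unset Strict Implicit. Unset Printing Implicit Defensive.
Import Order.TTheory GRing.Theory Num.Theory.
Local Open Scope ring_scope.
Local Open Scope complex_scope.

(* Basis index of (C^2)^{(x)n}: i : 'I_(2^n); site k (0-based, k < n) carries the
   bit k of i (least significant bit = site 0 = physical site 1). *)
Lemma exp2_gt0 n : (0 < 2 ^ n)%N. Proof. by rewrite expn_gt0. Qed.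
Definition mkidx (n x : nat) : 'I_(2 ^ n) := Ordinal (ltn_pmod x (exp2_gt0 n)).
Definition bit (k i : nat) : 'I_2 := inord (odd (i %/ 2 ^ k)).

Definition site_succ n (i : 'I_n) : 'I_n :=
  Ordinal (ltn_pmod i.+1 (leq_ltn_trans (leq0n i) (ltn_ord i))).

Section Qubits.
Variable R : realType.
Notation C := R[i].

Definition pauli (a : 'I_3) : 'M[C]_2 :=
  match val a with
  | 0 => \matrix_(i, j) (if i == j then 0 else 1)
  | 1 => \matrix_(i, j) (if i == j then 0 else if (val i == 0)%N then - 'i else 'i)
  | _ => \matrix_(i, j) (if i == j then (if (val i == 0)%N then 1 else -1) else 0)
  end.

Definition site_op (n k : nat) (s : 'M[C]_2) : 'M[C]_(2 ^ n) :=
  \matrix_(i, j) (s (bit k i) (bit k j) *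
     \prod_(l < n | (l != k :> nat)) ((bit l i == bit l j)%:R : C)).

Definition Hloc n (h : 'I_n -> 'I_3 -> R) (J : 'I_n -> 'I_3 -> 'I_3 -> R)
  (i : 'I_n) : 'M[C]_(2 ^ n) :=
  \sum_(a < 3) (h i a)%:C *: site_op n i (pauli a)
  + \sum_(a < 3) \sum_(b < 3)
      (J i a b)%:C *: (site_op n i (pauli a) *m site_op n (site_succ i) (pauli b)).

Definition Htot n h J : 'M[C]_(2 ^ n) := \sum_(i < n) Hloc (n := n) h J i.

(* cyclic translation by one site: T O_k T^{-1} = O_{k+1 mod n} *)
Definition transl (n : nat) : 'M[C]_(2 ^ n) :=
  \matrix_(i, j) \prod_(k < n) ((bit k i == bit ((k + n.-1) %% n) j)%:R : C).

Definition adjm p q (M : 'M[C]_(p, q)) : 'M[C]_(q, p) := map_mx conjc M^T.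

Definition vnorm2 d (v : 'cV[C]_d) : R :=
  \sum_i (complex.Re (v i 0) ^+ 2 + complex.Im (v i 0) ^+ 2).
Definition opnorm d (M : 'M[C]_d) : R :=
  sup [set r | exists v : 'cV[C]_d, vnorm2 v = 1 /\ r = Num.sqrt (vnorm2 (M *m v))].

(* partial trace over B = sites m..n-1, keeping A = sites 0..m-1 *)
Definition ptraceB (n m : nat) (X : 'M[C]_(2 ^ n)) : 'M[C]_(2 ^ m) :=
  \matrix_(a, a') \sum_(b < 2 ^ (n - m))
     X (mkidx n (a + 2 ^ m * b)) (mkidx n (a' + 2 ^ m * b)).

Definition spec k (M : 'M[C]_k) : seq C :=
  sval (closed_field_poly_normal (char_poly M)).

(* von Neumann entropy S(rho) = - tr (rho ln rho) = - sum_lambda lambda ln lambda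
   (with 0 ln 0 = 0) *)
Definition vN_entropy k (rho : 'M[C]_k) : R :=
  - \sum_(z <- spec rho)
      (if complex.Re z == 0 then 0 else complex.Re z * ln (complex.Re z)).

(* infinite-temperature expectation <X> = 2^{-n} tr X (real part; X Hermitian) *)
Definition expect n (X : 'M[C]_(2 ^ n)) : R :=
  complex.Re (\tr X) / (2 ^ n)%:R.

End Qubits.
Arguments ptraceB {R} n m X.

(* Main.v *)
(* Translation invariance gives every local term the same expectation e = E_j / n
   in the eigenstate |j>.  On A the r = m/2 terms H_1, H_3, ..., H_{m-1} act on
   disjoint pairs, so they commute.  The Gibbs variational principle with
   G = e (H_1 + H_3 + ...) reads
     S(rho_{j,A}) <= - tr (rho_{j,A} G) + ln tr exp G.
   Since the H_i are traceless with norm at most 1, one has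
   tr exp G <= 2^m (cosh e)^r <= 2^m exp (r e^2 / 2), whence
   S(rho_{j,A}) <= m ln 2 - m e^2 / 4.  Finally the average of E_j^2 is <H^2>, which
   equals n <H_1^2> because the local terms are pairwise trace-orthogonal.

   No matrix exponential is formed: it is replaced by the product X of the
   commuting factors cosh e + sinh e H_i, which lies above every tangent line
   exp c (1 - c + G).  Taking c = <v|G|v> in the operator inequality gives
   exp <v|G|v> <= <v|X|v> for each eigenvector v of rho_{j,A}. *)
Require Import Defs.
From mathcomp Require Import all_boot all_order all_algebra.
From mathcomp Require Import boolp classical_sets reals.
From mathcomp Require Import topology normedtype sequences derive realfun exp.
From mathcomp Require Import complex spectral sesquilinear.
From mathcomp Require Import zify ring lra.
Set Implicit Arguments. Unset Strict Implicit. Unset Printing Implicit Defensive.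
Import Order.TTheory GRing.Theory Num.Theory.
Local Open Scope ring_scope.
Local Open Scope complex_scope.

(** * The hyperbolic cosine *)

Section Cosh.
Import numFieldNormedType.Exports.
Variable R : realType.

Lemma is_derive_ge0_le (f df : R -> R) :
  (forall x : R, is_derive x 1 f (df x)) -> (forall x, 0 < x -> 0 <= df x) ->
  forall x, 0 <= x -> f 0 <= f x.
Proof.
move=> fdf df_ge0 x x_ge0.
have dvf y : derivable f y 1 by case: (fdf y).
apply: (@ger0_derive1_ndecry _ f 0) => //.
- by move=> y; rewrite in_itv /= andbT derive1E derive_val => /df_ge0.
- exact: derivable_within_continuous.
Qed.

Lemma is_derive_expRN (x : R) :
  is_derive x 1 (fun y : R => expR (- y)) (- expR (- x)).
Proof.
have := @is_derive1_comp _ (@expR R) -%R x _ _ (is_derive_expR _) (is_deriveNid _ _).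
by rewrite mulrN1.
Qed.

Lemma is_derive_expRNsqr2 (x : R) :
  is_derive x 1 (fun y : R => expR (- (y ^+ 2 / 2))) (- x * expR (- (x ^+ 2 / 2))).
Proof.
have dsq : is_derive x 1 (fun y : R => - (y ^+ 2 / 2)) (- x).
  rewrite (_ : (fun y => _) = (fun y : R => (- 2^-1) *: (y ^+ 2 : R))); last first.
    by apply/funext => y; rewrite /GRing.scale /=; field.
  apply: is_derive_eq.
  by rewrite /GRing.scale /=; field.
have := @is_derive1_comp _ (@expR R) (fun y => - (y ^+ 2 / 2)) x _ _ (is_derive_expR _) dsq.
by rewrite mulrC.
Qed.

(** The difference of the two sides vanishes at 0 and has derivative y (exp y - exp (-y)),
    nonnegative for y > 0. *)
Lemma sinh_le_mul_cosh (x : R) : 0 <= x ->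
  expR x - expR (- x) <= x * (expR x + expR (- x)).
Proof.
move=> x_ge0; rewrite -subr_ge0.
pose f (y : R) := y * (expR y + expR (- y)) - (expR y - expR (- y)).
have f0 : f 0 = 0 by rewrite /f oppr0 mul0r subrr subr0.
rewrite -[X in _ <= X]/(f x) -f0.
apply: (is_derive_ge0_le (df := fun y => y * (expR y - expR (- y)))) => // y.
- have := is_derive_expRN y => dN.
  apply: is_derive_eq.
  by rewrite /GRing.scale /=; ring.
- move=> y_gt0; rewrite mulr_ge0 ?(ltW y_gt0)// subr_ge0 ler_expR.
  by lra.
Qed.

Lemma cosh_le_expR_sqr2 (x : R) : (expR x + expR (- x)) / 2 <= expR (x ^+ 2 / 2).
Proof.
wlog x_ge0 : x / 0 <= x.
  move=> ih; have [/ih//|x_lt0] := leP 0 x.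
  have := ih (- x); rewrite opprK sqrrN addrC => -> //.
  by rewrite oppr_ge0 ltW.
(* The quotient of cosh by the Gaussian decreases on y >= 0 by [sinh_le_mul_cosh]; the sign turns
   this into monotone growth from y = 0. *)
pose f (y : R) := - ((expR y + expR (- y)) * expR (- (y ^+ 2 / 2))).
have : f 0 <= f x.
  apply: (is_derive_ge0_le (df := fun y =>
    (y * (expR y + expR (- y)) - (expR y - expR (- y))) *
      expR (- (y ^+ 2 / 2)))) => // y.
  - have := is_derive_expRN y => dN; have := is_derive_expRNsqr2 y => dS.
    apply: is_derive_eq.
    by rewrite /GRing.scale /=; ring.
  - move=> y_gt0; rewrite mulr_ge0 ?expR_ge0// subr_ge0.
    exact/sinh_le_mul_cosh/ltW.
rewrite /f lerN2 oppr0 expr0n /= mul0r oppr0 expR0 mulr1 [expR (- (_ / _))]expRN.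
by rewrite (ler_pdivrMr _ _ (expR_gt0 _)) => fx; rewrite ler_pdivrMr// mulrC.
Qed.

End Cosh.

(** * The Gibbs variational principle *)

Section Gibbs.
Variable R : realType.

Lemma ln_le_sub1 (y : R) : 0 < y -> ln y <= y - 1.
Proof.
by move=> y_gt0; have := @le_ln1Dx R (y - 1); rewrite [1 + _]addrC subrK; apply; lra.
Qed.

(** Termwise consequence of ln t <= t - 1 at t = exp (g i) / (p i Z). Allowing any x above exp g is
    what later lets [X] replace exp G. *)
Lemma gibbs_inequality (I : finType) (p g x : I -> R) :
  (forall i, 0 <= p i) -> \sum_i p i = 1 -> (forall i, expR (g i) <= x i) ->
  - \sum_i (if p i == 0 then 0 else p i * ln (p i)) <=
  - \sum_i p i * g i + ln (\sum_i x i).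
Proof.
move=> p_ge0 sum_p gx; set Z := \sum_i x i.
have x_gt0 i : 0 < x i by apply: lt_le_trans (gx i); apply: expR_gt0.
have Z_gt0 : 0 < Z.
  have : exists i : I, true.
    apply/existsP; apply: contraPT sum_p => /existsPn noI.
    rewrite big1 => [|i _]; first by move/eqP; rewrite eq_sym oner_eq0.
    by have := noI i.
  case=> i _; rewrite /Z (bigD1 i) //=; apply: ltr_wpDr => //.
  by apply: sumr_ge0 => j _; exact: ltW.
(* The right-hand sides sum to 1 - 1 = 0, since Z is the sum of x and p has total mass 1. *)
suff: \sum_i (- (if p i == 0 then 0 else p i * ln (p i)) + p i * g i
              - p i * ln Z) <= \sum_i (x i / Z - p i).
  rewrite !(big_split, sumrN) /= -!mulr_suml sum_p.
  rewrite mulfV ?gt_eqF//; lra.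
apply: ler_sum => i _; case: eqP => [->|/eqP p_neq0].
  by rewrite !mul0r oppr0 !addr0 divr_ge0 ?ltW.
have p_gt0 : 0 < p i by rewrite lt_neqAle eq_sym p_neq0 p_ge0.
have e_gt0 := expR_gt0 (g i).
have pZ_gt0 : 0 < p i * Z by rewrite mulr_gt0.
have := @ln_le_sub1 (expR (g i) / (p i * Z)) (divr_gt0 e_gt0 pZ_gt0).
rewrite ln_div ?posrE// lnM ?posrE// expRK => hln.
have := ler_wpM2l (p_ge0 i) hln => {}hln.
have -> : - (p i * ln (p i)) + p i * g i - p i * ln Z =
          p i * (g i - (ln (p i) + ln Z)) by ring.
apply: le_trans hln _.
have -> : p i * (expR (g i) / (p i * Z) - 1) = expR (g i) / Z - p i.
  by field; rewrite ?p_neq0 ?gt_eqF.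
by rewrite lerD2r ler_pM2r ?invr_gt0.
Qed.

End Gibbs.

(** * Adjoints, positive semidefinite matrices and entropy *)

Section Adjoint.
Variable R : realType.
Local Notation C := R[i].
Implicit Types (p q r : nat).

Lemma adjmM p q r (A : 'M[C]_(p, q)) (B : 'M[C]_(q, r)) :
  adjm (A *m B) = adjm B *m adjm A.
Proof. by rewrite /adjm trmx_mul map_mxM. Qed.

Lemma adjmK p q (A : 'M[C]_(p, q)) : adjm (adjm A) = A.
Proof. by apply/matrixP => i j; rewrite !mxE conjcK. Qed.

Lemma adjmD p q (A B : 'M[C]_(p, q)) : adjm (A + B) = adjm A + adjm B.
Proof. by rewrite /adjm linearD map_mxD. Qed.

Lemma adjm_sum (I : Type) (s : seq I) p q (F : I -> 'M[C]_(p, q)) :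
  adjm (\sum_(i <- s) F i) = \sum_(i <- s) adjm (F i).
Proof.
elim/big_rec2: _ => [|i x y _ <-]; last by rewrite adjmD.
by rewrite /adjm trmx0 map_mx0.
Qed.

Lemma adjmZ p q (c : C) (A : 'M[C]_(p, q)) : adjm (c *: A) = conjc c *: adjm A.
Proof. by rewrite /adjm linearZ /= map_mxZ. Qed.

Lemma adjmZr p q (c : R) (A : 'M[C]_(p, q)) : adjm (c%:C *: A) = c%:C *: adjm A.
Proof. by rewrite adjmZ conjc_real. Qed.

Lemma adjm1 p : adjm 1%:M = 1%:M :> 'M[C]_p.
Proof. by rewrite /adjm trmx1 map_mx1. Qed.

Lemma Re_realM (a : R) (z : C) : complex.Re (a%:C * z) = a * complex.Re z.
Proof. by case: z => x y /=; rewrite mul0r subr0. Qed.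

Lemma ReD (x y : C) : complex.Re (x + y) = complex.Re x + complex.Re y.
Proof. by case: x; case: y. Qed.

Lemma ReB (x y : C) : complex.Re (x - y) = complex.Re x - complex.Re y.
Proof. by case: x; case: y. Qed.

Lemma vnorm2E p (v : 'cV[C]_p) : (vnorm2 v)%:C = (adjm v *m v) 0 0.
Proof.
rewrite mxE rmorph_sum; apply: eq_bigr => i _.
by rewrite !mxE mulrC; apply: etrans (add_Re2_Im2 (v i 0)) _; rewrite normCK.
Qed.

Lemma vnorm2_ge0 p (v : 'cV[C]_p) : 0 <= vnorm2 v.
Proof. by apply: sumr_ge0 => i _; rewrite addr_ge0 ?sqr_ge0. Qed.

Lemma vnorm2Z p (c : R) (v : 'cV[C]_p) : vnorm2 (c%:C *: v) = c ^+ 2 * vnorm2 v.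
Proof.
apply: (@complexI R); rewrite rmorphM rmorphXn /= !vnorm2E adjmZr.
by rewrite -scalemxAl -scalemxAr scalerA mxE.
Qed.

Lemma hermitian_spectral p (A : 'M[C]_p) : adjm A = A ->
  exists P : 'M[C]_p, exists D : 'I_p -> R,
    [/\ adjm P *m P = 1%:M, P *m adjm P = 1%:M &
        A = adjm P *m diag_mx (\row_i (D i)%:C) *m P].
Proof.
move=> hA.
have hermA : A \is hermsymmx.
  by apply/is_hermitianmxP; rewrite expr0 scale1r; exact/esym.
have Pu := spectral_unitarymx A.
have PP : spectralmx A *m adjm (spectralmx A) = 1%:M by exact/unitarymxP.
exists (spectralmx A), (fun i => complex.Re (spectral_diag A 0 i)); split => //.
  exact: mulmx1C.
have /orthomx_spectralP {1}-> := hermitian_normalmx hermA.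
rewrite (invmx_unitary Pu); congr (_ *m diag_mx _ *m _).
apply/rowP => i; rewrite mxE RRe_real//.
by have /mxOverP := hermitian_spectral_diag_real hermA; apply.
Qed.

(** In the order of [R[i]], 0 <= z says that z is real and nonnegative. *)
Definition psd p (A : 'M[C]_p) := forall v : 'cV[C]_p, 0 <= (adjm v *m A *m v) 0 0.

Lemma psdD p (A B : 'M[C]_p) : psd A -> psd B -> psd (A + B).
Proof. by move=> hA hB v; rewrite mulmxDr mulmxDl mxE addr_ge0. Qed.

Lemma psdZ p (c : R) (A : 'M[C]_p) : 0 <= c -> psd A -> psd (c%:C *: A).
Proof.
by move=> c_ge0 hA v; rewrite -scalemxAr -scalemxAl mxE mulr_ge0 ?ler0c.
Qed.

Lemma psd1 p : psd (1%:M : 'M[C]_p).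
Proof. by move=> v; rewrite mulmx1 -vnorm2E ler0c vnorm2_ge0. Qed.

Lemma psd_conj p q (A : 'M[C]_p) (V : 'M[C]_(p, q)) :
  psd A -> psd (adjm V *m A *m V).
Proof. by move=> hA v; have := hA (V *m v); rewrite adjmM !mulmxA. Qed.

Lemma psd_sum (I : Type) (s : seq I) p (F : I -> 'M[C]_p) :
  (forall i, psd (F i)) -> psd (\sum_(i <- s) F i).
Proof.
move=> hF; elim/big_rec: _ => [v|i A _ hA]; last exact: psdD.
by rewrite mulmx0 mul0mx mxE.
Qed.

Lemma psd_diag_ge0 p (A : 'M[C]_p) i : psd A -> 0 <= A i i.
Proof.
move=> /(_ (delta_mx i 0)); congr (0 <= _).
by rewrite /adjm trmx_delta map_delta_mx -rowE -colE !mxE.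
Qed.

(** The root is taken on the eigenvalues. The commutation clause is what makes it usable in
    [psd_mul]. *)
Lemma psd_sqrt p (B : 'M[C]_p) : adjm B = B -> psd B ->
  exists2 S : 'M[C]_p, adjm S = S &
    S *m S = B /\ (forall A, A *m B = B *m A -> A *m S = S *m A).
Proof.
move=> hB psdB; have [P [D [PP' PP defB]]] := hermitian_spectral hB.
have D_ge0 i : 0 <= D i.
  have := psd_diag_ge0 i (psd_conj (adjm P) psdB).
  rewrite adjmK defB !mulmxA PP mul1mx -mulmxA PP mulmx1 !mxE eqxx mulr1n.
  by rewrite ler0c.
pose E := diag_mx (\row_i (Num.sqrt (D i))%:C).
have hE : adjm E = E.
  rewrite /adjm /E tr_diag_mx map_diag_mx; congr diag_mx.
  by apply/rowP => i; rewrite !mxE; exact: conjc_real.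
exists (adjm P *m E *m P); first by rewrite !adjmM adjmK hE mulmxA.
split.
  rewrite !mulmxA -[_ *m P *m adjm P]mulmxA PP mulmx1 -[_ *m E *m E]mulmxA.
  rewrite defB; congr (_ *m _ *m _); rewrite mulmx_diag; congr diag_mx.
  by apply/rowP => i; rewrite !mxE -rmorphM -expr2 sqr_sqrtr.
move=> A AB.
have comm' : (P *m A *m adjm P) *m E = E *m (P *m A *m adjm P).
  have : (P *m A *m adjm P) *m diag_mx (\row_i (D i)%:C) =
         diag_mx (\row_i (D i)%:C) *m (P *m A *m adjm P).
    have -> : diag_mx (\row_i (D i)%:C) = P *m B *m adjm P.
      by rewrite defB !mulmxA PP mul1mx -mulmxA PP mulmx1.
    rewrite !mulmxA -[_ *m adjm P *m P]mulmxA PP' mulmx1 -(mulmxA P) AB.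
    by rewrite -[_ *m adjm P *m P]mulmxA PP' mulmx1 !mulmxA.
  (* Commuting with the diagonal of D forces entry (i, j) to vanish unless D i = D j, and then the
     square roots agree too. *)
  move: (P *m A *m adjm P) => A' /matrixP cA; apply/matrixP => i j.
  have := cA i j; rewrite /E !mul_mx_diag !mul_diag_mx !mxE.
  have [<-|Dij] := eqVneq (D i) (D j); first by move=> _; rewrite mulrC.
  rewrite mulrC => /eqP; rewrite -subr_eq0 -mulrBl mulf_eq0 -rmorphB.
  rewrite fmorph_eq0 subr_eq0 eq_sym (negPf Dij) /= => /eqP->.
  by rewrite mul0r mulr0.
have := congr1 (fun X => adjm P *m X *m P) comm'; rewrite /= !mulmxA.
by rewrite PP' mul1mx -!mulmxA PP' !mulmx1.
Qed.

(** With S the square root of B, which commutes with A, the product A B equals S A S, a congruence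
    of A. *)
Lemma psd_mul p (A B : 'M[C]_p) : psd A -> psd B -> adjm B = B ->
  A *m B = B *m A -> psd (A *m B).
Proof.
move=> psdA psdB hB AB; have [S hS [SS commS]] := psd_sqrt hB psdB.
by have := psd_conj S psdA; rewrite hS -(commS _ AB) -mulmxA SS.
Qed.

Lemma char_poly_conj p (A P Q : 'M[C]_p) : Q *m P = 1%:M ->
  char_poly (Q *m A *m P) = char_poly A.
Proof.
move=> QP; rewrite /char_poly /char_poly_mx !map_mxM.
have QPX : map_mx polyC Q *m map_mx polyC P = 1%:M by rewrite -map_mxM QP map_mx1.
rewrite -[in LHS](mulmx1 'X%:M) -QPX mulmxA -scalar_mxC -mulmxBl -mulmxBr.
rewrite !det_mulmx mulrAC -det_mulmx QPX det1 mul1r; congr (\det (_ - _)).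
Qed.

Lemma char_poly_diag p (D : 'rV[C]_p) :
  char_poly (diag_mx D) = \prod_i ('X - (D 0 i)%:P).
Proof.
rewrite char_poly_trig ?diag_mx_is_trig//.
by apply: eq_bigr => i _; rewrite mxE eqxx mulr1n.
Qed.

(** [spec] lists the roots in an unspecified order; unique factorization of the characteristic
    polynomial makes it a permutation of D. *)
Lemma sum_spec p (A P : 'M[C]_p) (D : 'rV[C]_p) (f : C -> R) :
  adjm P *m P = 1%:M -> A = adjm P *m diag_mx D *m P ->
  \sum_(z <- spec A) f z = \sum_i f (D 0 i).
Proof.
move=> PP defA; rewrite /spec; case: closed_field_poly_normal => s /= hs.
have : perm_eq s [seq D 0 i | i <- index_enum 'I_p].
  apply: prod_XsubC_eq; rewrite big_map -char_poly_diag.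
  rewrite -(char_poly_conj _ PP) -defA hs.
  by rewrite (monicP (char_poly_monic A)) scale1r.
by move=> /(perm_big _) -> /=; rewrite big_map.
Qed.

(** In an eigenbasis of rho, the diagonals of rho, G and X serve as p, g and x in
    [gibbs_inequality]. *)
Lemma vN_entropy_gibbs p (rho X G : 'M[C]_p) :
  adjm rho = rho -> psd rho -> \tr rho = 1 ->
  (forall c : R, psd (X - (expR c)%:C *: ((1 - c)%:C%:M + G))) ->
  vN_entropy rho <= - complex.Re (\tr (rho *m G)) + ln (complex.Re (\tr X)).
Proof.
move=> hrho psdrho trrho psdX.
have [P [D [PP' PP defrho]]] := hermitian_spectral hrho.
rewrite /vN_entropy (sum_spec _ PP' defrho).
pose cj (A : 'M[C]_p) := P *m A *m adjm P.
have tr_cj A : \tr (cj A) = \tr A.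
  by rewrite /cj mxtrace_mulC mulmxA PP' mul1mx.
have psd_cj A i : psd A -> 0 <= cj A i i.
  by move=> hA; have := psd_diag_ge0 i (psd_conj (adjm P) hA); rewrite adjmK.
have cj_rho : cj rho = diag_mx (\row_i (D i)%:C).
  by rewrite /cj defrho !mulmxA PP mul1mx -mulmxA PP mulmx1.
have cj_rhoii i : cj rho i i = (D i)%:C by rewrite cj_rho !mxE eqxx mulr1n.
pose g i := complex.Re (cj G i i); pose x i := complex.Re (cj X i i).
have -> : complex.Re (\tr X) = \sum_i x i.
  by rewrite -tr_cj /mxtrace raddf_sum.
have -> : complex.Re (\tr (rho *m G)) = \sum_i D i * g i.
  rewrite -tr_cj.
  have -> : cj (rho *m G) = cj rho *m cj G.
    by rewrite /cj !mulmxA -[_ *m adjm P *m P]mulmxA PP' mulmx1.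
  rewrite cj_rho mul_diag_mx /mxtrace raddf_sum; apply: eq_bigr => i _ /=.
  by rewrite mxE mxE; exact: Re_realM.
have D_ge0 i : 0 <= D i by rewrite -ler0c -cj_rhoii psd_cj.
apply: le_trans (gibbs_inequality (p := D) (g := g) (x := x) _ _ _) => //.
- by under eq_bigr do rewrite mxE.
- apply: (@complexI R); rewrite rmorph_sum /= -[RHS]trrho -tr_cj.
  by apply: eq_bigr => i _; rewrite cj_rhoii.
(* The tangent at c = g i touches there: 1 - c + g i = 1, so the i-th diagonal entry reads exp (g i)
   <= x i. *)
- move=> i; have := psd_cj _ i (psdX (g i)).
  have -> : cj (X - (expR (g i))%:C *: ((1 - g i)%:C%:M + G)) =
    cj X - (expR (g i))%:C *: ((1 - g i)%:C%:M + cj G).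
    rewrite /cj mulmxBr mulmxBl -scalemxAr -scalemxAl mulmxDr mulmxDl.
    by rewrite scalar_mxC -[_%:M *m _ *m _]mulmxA PP mulmx1.
  have entry (A B : 'M[C]_p) (a b : C) :
      (A - a *: (b%:M + B)) i i = A i i - a * (b + B i i).
    by rewrite !mxE eqxx mulr1n.
  rewrite entry lecE => /andP[_].
  by rewrite ReB Re_realM ReD -/(g i) -/(x i) /= subrK mulr1 subr_ge0.
Qed.

End Adjoint.

(** * Commuting contractions *)

Section Peierls.
Variable R : realType.
Local Notation C := R[i].

Definition cosh (l : R) : R := (expR l + expR (- l)) / 2.
Definition sinh (l : R) : R := (expR l - expR (- l)) / 2.

(** On [-1, 1], cosh l + t sinh l is the chord of exp (l t), which lies above it by convexity. For
    commuting H k of square 1 the product is exactly the exponential of l times their sum. *)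
Fixpoint cosh_prod p (H : nat -> 'M[C]_p) (l : R) (r : nat) : 'M[C]_p :=
  if r is r'.+1 then
    cosh_prod H l r' *m ((cosh l)%:C%:M + (sinh l)%:C *: H r')
  else 1%:M.

Lemma comm_cosh_prod p (H : nat -> 'M[C]_p) l r (Y : 'M[C]_p) :
  (forall k, (k < r)%N -> Y *m H k = H k *m Y) ->
  Y *m cosh_prod H l r = cosh_prod H l r *m Y.
Proof.
elim: r => [|r ih] hY /=; first by rewrite mulmx1 mul1mx.
rewrite mulmxA ih => [|k kr]; last by apply: hY; exact: ltnW.
rewrite -!mulmxA; congr (_ *m _).
by rewrite mulmxDr mulmxDl -scalemxAl -scalemxAr hY// scalar_mxC.
Qed.

(* With a = exp l, b = exp (-l), e = exp c, the two summands on the right are the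
   tangent-line bounds for X at c - l and c + l, each times a factor
   (1 + H)/2 or (1 - H)/2 that is positive and commutes with X. *)
Lemma cosh_prod_step p (X G H : 'M[C]_p) (a b c e l : C) :
  X *m (((a + b) / 2)%:M + ((a - b) / 2) *: H)
    - e *: ((1 - c)%:M + l *: (G + H)) =
  2^-1 *: ((a *: X - e *: ((1 - (c - l))%:M + l *: G)) *m (1%:M + H)
         + (b *: X - e *: ((1 - (c + l))%:M + l *: G)) *m (1%:M - H)).
Proof.
have mulH d f : (d *: X - e *: (f%:M + l *: G)) *m H =
    d *: (X *m H) - e *: (f *: H + l *: (G *m H)).
  by rewrite mulmxBl -!scalemxAl mulmxDl mul_scalar_mx -scalemxAl.
have mulD (A : 'M[C]_p) : A *m (1%:M + H) = A + A *m H.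
  by rewrite mulmxDr mulmx1.
have mulB (A : 'M[C]_p) : A *m (1%:M - H) = A - A *m H.
  by rewrite mulmxBr mulmx1.
rewrite mulD mulB !mulH.
rewrite mulmxDr mul_mx_scalar -scalemxAr.
move: (X *m H) (G *m H) => XH GH; apply/matrixP => i j; rewrite !mxE.
case: (i == j); rewrite ?mulr1n ?mulr0n; by field.
Qed.

(** Induction on r, for all c at once: the step at c uses the bounds at c - l and c + l, through
    [cosh_prod_step] and [psd_mul]. *)
Lemma cosh_prod_tangent p (H : nat -> 'M[C]_p) (l : R) (r : nat) :
  (forall k, (k < r)%N ->
     [/\ adjm (H k) = H k, psd (1%:M + H k) & psd (1%:M - H k)]) ->
  (forall j k, (j < k < r)%N -> H j *m H k = H k *m H j) ->
  forall c : R, psd (cosh_prod H l r -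
    (expR c)%:C *: ((1 - c)%:C%:M + l%:C *: \sum_(k < r) H k)).
Proof.
elim: r => [|r ih] hH commH c.
  rewrite big_ord0 scaler0 addr0 /=.
  have -> : 1%:M - (expR c)%:C *: (1 - c)%:C%:M =
            (1 - expR c * (1 - c))%:C *: 1%:M :> 'M[C]_p.
    by rewrite scalemx1 scale_scalar_mx -rmorphM rmorphB rmorph1 [RHS]raddfB.
  apply: psdZ; last exact: psd1.
  (* For the empty product the claim is exp c (1 - c) <= 1, that is 1 - c <= exp (-c). *)
  rewrite subr_ge0 -[leRHS](expRxMexpNx_1 c) ler_pM2l ?expR_gt0//.
  exact: expR_ge1Dx.
have {}ih := ih (fun k kr => hH k (ltnW kr)).
have {ih}/ih ih : forall j k, (j < k < r)%N -> H j *m H k = H k *m H j.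
  by move=> j k /andP[jk kr]; rewrite commH// jk ltnW.
have [hHr psdp psdm] := hH r (ltnSn r).
have commX d : (cosh_prod H l r -
    (expR d)%:C *: ((1 - d)%:C%:M + l%:C *: \sum_(k < r) H k)) *m H r =
    H r *m (cosh_prod H l r -
    (expR d)%:C *: ((1 - d)%:C%:M + l%:C *: \sum_(k < r) H k)).
  rewrite mulmxBl mulmxBr comm_cosh_prod => [|k kr]; last first.
    by rewrite (commH k r) ?kr ?ltnSn.
  rewrite -scalemxAl -scalemxAr mulmxDl mulmxDr -scalemxAl -scalemxAr scalar_mxC.
  rewrite mulmx_suml mulmx_sumr.
  congr (_ - _ *: (_ + _ *: _)); apply: eq_bigr => k _.
  by rewrite commH// ltn_ord ltnSn.
rewrite big_ord_recr /= /cosh /sinh.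
have -> : ((expR l + expR (- l)) / 2)%:C = ((expR l)%:C + (expR (- l))%:C) / 2 :> C.
  by rewrite rmorphM rmorphD fmorphV /= rmorph_nat.
have -> : ((expR l - expR (- l)) / 2)%:C = ((expR l)%:C - (expR (- l))%:C) / 2 :> C.
  by rewrite rmorphM rmorphB fmorphV /= rmorph_nat.
rewrite rmorphB rmorph1 cosh_prod_step.
(* Used with (a, b) = (l, c - l) and (- l, c + l); in both cases a + b = c, the common factor that
   [cosh_prod_step] requires. *)
have scl a b : (expR a)%:C *: (cosh_prod H l r -
    (expR b)%:C *: ((1 - b)%:C%:M + l%:C *: \sum_(k < r) H k)) =
   (expR a)%:C *: cosh_prod H l r - (expR (a + b))%:C *:
       ((1 - b%:C)%:M + l%:C *: \sum_(k < r) H k).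
  by rewrite scalerBr scalerA -rmorphM -expRD rmorphB rmorph1.
have := scl l (c - l); rewrite [l + _]addrC subrK [(c - l)%:C]rmorphB => <-.
have := scl (- l) (c + l); rewrite [- l + _]addrC addrK [(c + l)%:C]rmorphD => <-.
have -> : 2^-1 = (2^-1)%:C :> C by rewrite fmorphV rmorph_nat.
have comm1 (A B : 'M[C]_p) : A *m B = B *m A ->
    A *m (1%:M + B) = (1%:M + B) *m A.
  by move=> AB; rewrite mulmxDr mulmxDl mulmx1 mul1mx AB.
apply: psdZ; first by rewrite invr_ge0.
apply: psdD; rewrite -scalemxAl; (apply: psdZ; first exact: expR_ge0).
- apply: (psd_mul (ih _) psdp); first by rewrite adjmD adjm1 hHr.
  exact: comm1.
- apply: (psd_mul (ih _) psdm).
    by rewrite adjmD adjm1 -scaleN1r -(rmorphN1 (real_complex R)) adjmZr hHr.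
  by apply: comm1; rewrite mulmxN mulNmx commX.
Qed.

(** The sinh part of each new factor is traceless against the previous product, so each factor only
    multiplies the trace by cosh l. *)
Lemma trace_cosh_prod p (H : nat -> 'M[C]_p) (l : R) (r : nat) :
  (forall k, (k < r)%N -> \tr (cosh_prod H l k *m H k) = 0) ->
  \tr (cosh_prod H l r) = (cosh l ^+ r * p%:R)%:C.
Proof.
elim: r => [|r ih] hH /=; first by rewrite mxtrace1 mul1r rmorph_nat.
rewrite mulmxDr mul_mx_scalar -scalemxAr mxtraceD !mxtraceZ hH//.
rewrite mulr0 addr0 ih => [|k kr]; last by apply: hH; exact: ltnW.
by rewrite -rmorphM exprS mulrA.
Qed.

(* The supremum of an unbounded set is 0 by convention, so the value 1 already
   entails boundedness. *)
Lemma psd_opnorm1 p (A : 'M[C]_p) : adjm A = A -> opnorm A = 1 ->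
  psd (1%:M + A) /\ psd (1%:M - A).
Proof.
move=> hA normA.
have hs : has_sup [set r | exists v : 'cV[C]_p,
     vnorm2 v = 1 /\ r = Num.sqrt (vnorm2 (A *m v))]%classic.
  apply: contrapT => /sup_out; rewrite -/(opnorm A) normA => /eqP.
  by rewrite oner_eq0.
have unit_le (v : 'cV[C]_p) : vnorm2 v = 1 -> vnorm2 (A *m v) <= 1.
  move=> v1; rewrite -[leLHS]sqr_sqrtr ?vnorm2_ge0// expr_le1 ?sqrtr_ge0//.
  rewrite -normA; apply: (ub_le_sup (proj2 hs)); by exists v.
have le (v : 'cV[C]_p) : vnorm2 (A *m v) <= vnorm2 v.
  have := vnorm2_ge0 v; rewrite le_eqVlt => /predU1P[/esym v0|v_gt0].
    have -> : v = 0.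
      apply/colP => i; rewrite mxE; apply/eqP; move: v0 => /eqP.
      rewrite psumr_eq0 => [|j _]; last by rewrite addr_ge0 ?sqr_ge0.
      move=> /allP/(_ i); rewrite mem_index_enum => /(_ isT) /=.
      rewrite paddr_eq0 ?sqr_ge0// !sqrf_eq0; case: (v i 0) => a b /=.
      by rewrite eq_complex.
    by rewrite mulmx0.
  pose c := (Num.sqrt (vnorm2 v))^-1.
  have c2 : c ^+ 2 = (vnorm2 v)^-1 by rewrite exprVn sqr_sqrtr// ltW.
  have := @unit_le (c%:C *: v); rewrite -scalemxAr !vnorm2Z c2.
  by rewrite mulVf ?gt_eqF// mulrC ler_pdivrMr// mul1r; apply.
have AA v : (adjm v *m (A *m A) *m v) 0 0 = (vnorm2 (A *m v))%:C.
  by rewrite vnorm2E adjmM hA !mulmxA.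
have psd2 : psd (1%:M - A *m A).
  move=> v.
  have -> : (adjm v *m (1%:M - A *m A) *m v) 0 0 = (vnorm2 v - vnorm2 (A *m v))%:C.
    rewrite rmorphB /= -AA vnorm2E mulmxBr mulmxBl mulmx1.
    by move: (adjm v *m v) (adjm v *m (A *m A) *m v) => X Y; rewrite !mxE.
  by rewrite ler0c subr_ge0.
have hN : adjm (- A) = - A.
  by rewrite -scaleN1r -(rmorphN1 (real_complex R)) adjmZr hA.
(* 1 + B is half the sum of (1 + B)^2 and 1 - B^2, both positive; it is applied to A and - A. *)
have key (B : 'M[C]_p) : adjm B = B -> B *m B = A *m A -> psd (1%:M + B).
  move=> hB BB.
  have -> : 1%:M + B = (2^-1)%:C *:
     ((adjm (1%:M + B) *m 1%:M *m (1%:M + B)) + (1%:M - A *m A)).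
    rewrite adjmD adjm1 hB mulmx1 mulmxDr !mulmxDl !mulmx1 mul1mx BB.
    move: (A *m A) => A2; apply/matrixP => i j.
    rewrite !mxE fmorphV rmorph_nat; case: (i == j); rewrite ?mulr1n ?mulr0n; by field.
  apply: psdZ; first by rewrite invr_ge0.
  by apply: psdD psd2; exact/psd_conj/psd1.
by split; apply: key; rewrite ?hN// mulmxN mulNmx opprK.
Qed.

(** The V b abstract the embeddings of A indexed by a basis of B. The normalized partial trace
    [compr] fixes the identity, sends G to GA and preserves positivity, so the tangent bounds for X
    descend to A and [vN_entropy_gibbs] applies there. *)
Lemma vN_entropy_compress p q N (V : 'I_N -> 'M[C]_(q, p))
    (psi : 'cV[C]_q) (X G : 'M[C]_q) (GA : 'M[C]_p) :
  (0 < N)%N ->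
  (forall b, adjm (V b) *m V b = 1%:M) ->
  \sum_b V b *m adjm (V b) = 1%:M ->
  adjm psi *m psi = 1%:M ->
  (forall b, G *m V b = V b *m GA) ->
  (forall c : R, psd (X - (expR c)%:C *: ((1 - c)%:C%:M + G))) ->
  vN_entropy (\sum_b adjm (V b) *m (psi *m adjm psi) *m V b) <=
  - complex.Re ((adjm psi *m G *m psi) 0 0)
  + ln (complex.Re (\tr X) / N%:R).
Proof.
move=> N_gt0 VV sumV psi1 GV psdX.
pose compr (A : 'M[C]_q) := (N%:R^-1)%:C *: \sum_b adjm (V b) *m A *m V b.
have N_neq0 : (N%:R : R) != 0 by rewrite pnatr_eq0 -lt0n.
have sumN (A : 'M[C]_p) : (N%:R^-1)%:C *: \sum_(b < N) A = A.
  rewrite sumr_const card_ord -(@scaler_nat C) scalerA -(rmorph_nat (real_complex R)).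
  by rewrite -rmorphM mulVf// scale1r.
have tr_sum (A : 'M[C]_q) : \tr (\sum_b adjm (V b) *m A *m V b) = \tr A.
  rewrite raddf_sum /=; under eq_bigr do rewrite -mulmxA mxtrace_mulC -mulmxA.
  by rewrite -raddf_sum /= -mulmx_sumr sumV mulmx1.
have -> : complex.Re (\tr X) / N%:R = complex.Re (\tr (compr X)).
  by rewrite mxtraceZ tr_sum Re_realM mulrC.
have -> : (adjm psi *m G *m psi) 0 0 =
   \tr ((\sum_b adjm (V b) *m (psi *m adjm psi) *m V b) *m GA).
  rewrite mulmx_suml (eq_bigr (fun b => adjm (V b) *m (psi *m adjm psi *m G) *m V b)).
    by rewrite tr_sum -[psi *m _ *m G]mulmxA mxtrace_mulC [RHS]trace_mx11.
  by move=> b _; rewrite -mulmxA -GV !mulmxA.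
apply: vN_entropy_gibbs.
- by rewrite adjm_sum; apply: eq_bigr => b _; rewrite !adjmM !adjmK !mulmxA.
- apply: psd_sum => b; apply: psd_conj; rewrite -[psi in psi *m _]adjmK -[adjm (adjm _)]mulmx1.
  exact/psd_conj/psd1.
- by rewrite tr_sum mxtrace_mulC psi1 mxtrace1.
- move=> c.
  have -> : compr X - (expR c)%:C *: ((1 - c)%:C%:M + GA) =
    compr (X - (expR c)%:C *: ((1 - c)%:C%:M + G)).
    rewrite /compr; under [in RHS]eq_bigr => b _.
      rewrite mulmxBr mulmxBl -scalemxAr -scalemxAl mulmxDr mulmxDl.
      rewrite mul_mx_scalar -scalemxAl VV scalemx1 -[_ *m G *m _]mulmxA GV.
      rewrite [_ *m (V b *m GA)]mulmxA VV mul1mx.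
      over.
    by rewrite big_split /= [RHS]scalerDr sumN.
  by apply: psdZ; rewrite ?invr_ge0 ?ler0n//; apply: psd_sum => b; exact: psd_conj.
Qed.

End Peierls.

(** * Operators on qubits *)

Section Bits.

Lemma bitE k i : bit k i = odd (i %/ 2 ^ k) :> nat.
Proof. by rewrite /bit inordK// ltnS leq_b1. Qed.

Lemma eq_bits n x y : (x < 2 ^ n)%N -> (y < 2 ^ n)%N ->
  (forall l, (l < n)%N -> bit l x = bit l y) -> x = y.
Proof.
elim: n x y => [|n ih] x y; first by case: x; case: y.
rewrite expnS mul2n => hx hy hb.
have h0 : odd x = odd y.
  have := congr1 val (hb 0%N isT); rewrite /= !bitE expn0 !divn1.
  by case: (odd x); case: (odd y).
rewrite -[x]odd_double_half -[y]odd_double_half h0; congr (_ + _.*2)%N.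
apply: ih => [||l ln]; rewrite ?ltn_half_double//.
apply: val_inj; have := congr1 val (hb l.+1 ln).
by rewrite /= !bitE expnS !divnMA !divn2.
Qed.

Lemma bits_inj n : injective (fun x : 'I_(2 ^ n) => [ffun l : 'I_n => bit l x]).
Proof.
move=> x y /ffunP exy; apply/val_inj/(@eq_bits n); rewrite ?ltn_ord// => l ln.
by have := exy (Ordinal ln); rewrite !ffunE.
Qed.

Lemma bits_bij n : bijective (fun x : 'I_(2 ^ n) => [ffun l : 'I_n => bit l x]).
Proof. by apply: inj_card_bij (@bits_inj n) _; rewrite card_ffun !card_ord. Qed.

(** Distributivity, once indices are identified with bit strings; it lets tensor products be
    multiplied site by site. *)
Lemma sum_prod_bits (A : comPzRingType) n (F : 'I_n -> 'I_2 -> A) :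
  \sum_(x < 2 ^ n) \prod_(l < n) F l (bit l x) = \prod_(l < n) \sum_c F l c.
Proof.
rewrite bigA_distr_bigA (reindex _ (onW_bij _ (bits_bij n))) /=.
by apply: eq_bigr => x _; apply: eq_bigr => l _; rewrite ffunE.
Qed.

Lemma prod_bits_eq (A : comPzRingType) n (x y : 'I_(2 ^ n)) :
  \prod_(l < n) (bit l x == bit l y)%:R = (x == y)%:R :> A.
Proof.
have [->|xy] := eqVneq x y; first by rewrite big1 // => l _; rewrite eqxx.
have /existsP [l /negPf hl] : [exists l : 'I_n, bit l x != bit l y].
  apply: contraR xy => /existsPn h; apply/eqP/(@bits_inj n)/ffunP => l.
  by rewrite !ffunE; apply/eqP; have := h l; rewrite negbK.
by rewrite (bigD1 l) //= hl mul0r.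
Qed.

Lemma sum_mul_delta (A : pzRingType) (I : finType) (F : I -> A) c :
  \sum_x F x * (x == c)%:R = F c.
Proof.
rewrite (bigD1 c) //= eqxx mulr1 big1 ?addr0// => x /negPf->.
by rewrite mulr0.
Qed.

End Bits.

(** * Site operators, local terms and translation *)

Section SiteOps.
Variable R : realType.
Local Notation C := R[i].

(** The tensor product of the [f l]; it reduces the algebra of site operators to that of 2 x 2
    matrices. *)
Definition tens n (f : nat -> 'M[C]_2) : 'M[C]_(2 ^ n) :=
  \matrix_(i, j) \prod_(l < n) f l (bit l i) (bit l j).

Lemma tensM n f g : tens n f *m tens n g = tens n (fun l => f l *m g l).
Proof.
apply/matrixP => i j; rewrite !mxE; under eq_bigr do rewrite !mxE -big_split /=.
rewrite (sum_prod_bits (fun l c => f l (bit l i) c * g l c (bit l j))).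
by apply: eq_bigr => l _; rewrite mxE.
Qed.

Lemma eq_tens n f g : (forall l, (l < n)%N -> f l = g l) -> tens n f = tens n g.
Proof.
by move=> fg; apply/matrixP => i j; rewrite !mxE; apply: eq_bigr => l _; rewrite fg.
Qed.

Lemma tens1 n : tens n (fun=> 1%:M) = 1%:M.
Proof.
apply/matrixP => i j; rewrite !mxE -prod_bits_eq.
by apply: eq_bigr => l _; rewrite mxE.
Qed.

Lemma site_opE n k (s : 'M[C]_2) : (k < n)%N ->
  site_op n k s = tens n (fun l => if l == k then s else 1%:M).
Proof.
move=> kn; apply/matrixP => i j; rewrite !mxE [RHS](bigD1 (Ordinal kn)) //= eqxx.
by congr (_ * _); apply: eq_bigr => l /negPf lk; rewrite lk mxE.
Qed.

Lemma site_opM n k (s t : 'M[C]_2) : (k < n)%N ->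
  site_op n k s *m site_op n k t = site_op n k (s *m t).
Proof.
move=> kn; rewrite !site_opE// tensM; apply: eq_tens => l _.
by case: eqP => _ //; rewrite mulmx1.
Qed.

Lemma site_op_comm n k l (s t : 'M[C]_2) : (k < n)%N -> (l < n)%N -> k != l ->
  site_op n k s *m site_op n l t = site_op n l t *m site_op n k s.
Proof.
move=> kn ln kl; rewrite !site_opE// !tensM; apply: eq_tens => j _.
have [->|_] := eqVneq j k; last by rewrite mulmx1 mul1mx.
by rewrite (negPf kl) mulmx1 mul1mx.
Qed.

Lemma site_op1 n k : (k < n)%N -> site_op n k 1%:M = 1%:M :> 'M[C]_(2 ^ n).
Proof.
by move=> kn; rewrite site_opE// -tens1; apply: eq_tens => l _; case: ifP.
Qed.

Lemma site_opN n k (s : 'M[C]_2) : site_op n k (- s) = - site_op n k s.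
Proof. by apply/matrixP => i j; rewrite !mxE mulNr. Qed.

Lemma adjm_site_op n k (s : 'M[C]_2) : adjm (site_op n k s) = site_op n k (adjm s).
Proof.
apply/matrixP => i j; rewrite !mxE rmorphM rmorph_prod; congr (_ * _).
by apply: eq_bigr => l _; rewrite rmorph_nat eq_sym.
Qed.

Lemma ord2P (i : 'I_2) : i = 0 \/ i = 1.
Proof. by case: i => [[|[|//]] hi]; [left|right]; apply/val_inj. Qed.

Lemma adjm_pauli (a : 'I_3) : adjm (pauli R a) = pauli R a.
Proof.
apply/matrixP => i j; rewrite /pauli !mxE; case: a => [[|[|[|//]]] ha] /=; rewrite !mxE;
by case: (ord2P i) => ->; case: (ord2P j) => ->; apply/eqP;
  rewrite /= eq_complex /= ?oppr0 ?opprK ?eqxx.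
Qed.

Lemma pauli_anticomm (a : 'I_3) : exists b : 'I_3,
  pauli R b *m pauli R b = 1%:M /\
  pauli R a *m pauli R b = - (pauli R b *m pauli R a).
Proof.
(* sigma^z anticommutes with sigma^x, and sigma^x with both sigma^y and sigma^z. *)
exists (if val a == 0%N then inord 2 else inord 0); rewrite /pauli.
by case: a => [[|[|[|//]]] ha] /=; rewrite inordK//=; split; apply/matrixP => i j;
  rewrite !mxE !big_ord_recl !big_ord0 !mxE /=;
  case: (ord2P i) => ->; case: (ord2P j) => -> /=; apply/eqP; rewrite eq_complex /=;
  apply/andP; split; apply/eqP; ring.
Qed.

(** An algebraic way to say that Y acts as the identity on site k. *)
Definition comm_site n k (Y : 'M[C]_(2 ^ n)) :=
  forall s, Y *m site_op n k s = site_op n k s *m Y.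

(* Conjugating by a Pauli matrix on site k that anticommutes with the given one
   fixes Y and flips the sign of the trace. *)
Lemma trace_mul_site_op n k (Y : 'M[C]_(2 ^ n)) a : (k < n)%N -> comm_site k Y ->
  \tr (Y *m site_op n k (pauli R a)) = 0.
Proof.
move=> kn hY; have [b [bb ab]] := pauli_anticomm a.
set Q := site_op n k _; pose P := site_op n k (pauli R b).
have PP : P *m P = 1%:M by rewrite site_opM// bb site_op1.
have QP : Q *m P = - (P *m Q) by rewrite !site_opM// ab site_opN.
have trN : \tr (Y *m Q) = - \tr (Y *m Q).
  rewrite -{1}[Q]mulmx1 -PP [Q *m _]mulmxA QP mulNmx mulmxN raddfN /= !mulmxA hY.
  by congr (- _); rewrite -!mulmxA mxtrace_mulC -!mulmxA PP mulmx1.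
by move/eqP: trN; rewrite -subr_eq0 opprK -mulr2n mulrn_eq0 => /eqP.
Qed.

Lemma site_succ_neq n (i : 'I_n) : (2 <= n)%N -> i != site_succ i :> nat.
Proof.
move=> hn; rewrite /=; have [e|lt] := eqVneq i.+1 n.
  by rewrite e modnn; apply: contraTneq hn => i0; rewrite -e i0.
by rewrite modn_small ?neq_ltn ?ltnSn// ltn_neqAle lt ltn_ord.
Qed.

Section Hloc.
Variables (n : nat) (h : 'I_n -> 'I_3 -> R) (J : 'I_n -> 'I_3 -> 'I_3 -> R).
Implicit Types i k : 'I_n.

Lemma comm_Hloc (Y : 'M[C]_(2 ^ n)) i : comm_site i Y -> comm_site (site_succ i) Y ->
  Y *m Hloc h J i = Hloc h J i *m Y.
Proof.
move=> c0 c1; rewrite /Hloc mulmxDr mulmxDl !mulmx_sumr !mulmx_suml; congr (_ + _).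
  by apply: eq_bigr => a _; rewrite -scalemxAl -scalemxAr c0.
apply: eq_bigr => a _; rewrite mulmx_sumr mulmx_suml; apply: eq_bigr => b _.
by rewrite -scalemxAl -scalemxAr mulmxA c0 -!mulmxA c1.
Qed.

Lemma adjm_Hloc i : (2 <= n)%N -> adjm (Hloc h J i) = Hloc h J i.
Proof.
move=> hn; rewrite /Hloc adjmD !adjm_sum; congr (_ + _).
  by apply: eq_bigr => a _; rewrite adjmZr adjm_site_op adjm_pauli.
apply: eq_bigr => a _; rewrite adjm_sum; apply: eq_bigr => b _.
rewrite adjmZr adjmM !adjm_site_op !adjm_pauli site_op_comm ?ltn_ord//.
by rewrite eq_sym site_succ_neq.
Qed.

(** Every term carries a Pauli matrix on site i, so Y need only be trivial there: a second factor,
    on the next site, is absorbed into Y by cyclicity of the trace. *)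
Lemma trace_mul_Hloc (Y : 'M[C]_(2 ^ n)) i : (2 <= n)%N -> comm_site i Y ->
  \tr (Y *m Hloc h J i) = 0.
Proof.
move=> hn hY; rewrite /Hloc mulmxDr mxtraceD !mulmx_sumr !raddf_sum /= !big1 ?addr0//.
- move=> a _; rewrite mulmx_sumr raddf_sum /= big1// => b _.
  rewrite -scalemxAr mxtraceZ mulmxA mxtrace_mulC mulmxA trace_mul_site_op ?mulr0// => s.
  rewrite -mulmxA hY !mulmxA; congr (_ *m _).
  apply: (site_op_comm _ _ (ltn_ord (site_succ i)) (ltn_ord i)).
  by rewrite eq_sym site_succ_neq.
- by move=> a _; rewrite -scalemxAr mxtraceZ trace_mul_site_op ?mulr0.
Qed.

Lemma comm_site_Hloc i k : k != i -> k != site_succ i -> comm_site k (Hloc h J i).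
Proof.
move=> ki ks s; apply/esym/comm_Hloc => t; rewrite site_op_comm ?ltn_ord//.
Qed.

End Hloc.

(** The entries of the product factor over sites, each factor comparing one bit of j and j'; the
    cyclic predecessor merely permutes the factors. *)
Lemma transl_unitary n : adjm (transl R n) *m transl R n = 1%:M.
Proof.
apply/matrixP => j j'; rewrite !mxE.
under eq_bigr do rewrite !mxE rmorph_prod -big_split /=.
case: n j j' => [|n] j j'.
  rewrite [j]ord1 [j']ord1 eqxx; under eq_bigr do rewrite big_ord0.
  by rewrite sumr_const card_ord.
pose pr (k : 'I_n.+1) := bit ((k + n) %% n.+1).
rewrite (sum_prod_bits (fun k c => (c == pr k j)%:R^* * (c == pr k j')%:R)).
rewrite -prod_bits_eq [RHS](reindex_inj (@ord_pred_inj n.+1)) /=.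
apply: eq_bigr => k _; rewrite sum_mul_delta rmorph_nat /pr addnS /=.
by rewrite eq_sym.
Qed.

End SiteOps.

(** * The splitting into A and B, and the partial trace *)

Section Embedding.
Variables (R : realType) (n m : nat).
Local Notation C := R[i].

(* embB b sends |a> to |a> (x) |b>. *)
Definition embB (b : 'I_(2 ^ (n - m))) : 'M[C]_(2 ^ n, 2 ^ m) :=
  \matrix_(x, a) (x == mkidx n (a + 2 ^ m * b))%:R.

Lemma mul_embB p (M : 'M[C]_(p, 2 ^ n)) b i a :
  (M *m embB b) i a = M i (mkidx n (a + 2 ^ m * b)).
Proof.
by rewrite mxE; under eq_bigr do rewrite mxE; rewrite sum_mul_delta.
Qed.

Lemma adjm_embB_mul p (M : 'M[C]_(2 ^ n, p)) b a j :
  (adjm (embB b) *m M) a j = M (mkidx n (a + 2 ^ m * b)) j.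
Proof.
rewrite mxE; under eq_bigr do rewrite !mxE rmorph_nat mulrC.
by rewrite sum_mul_delta.
Qed.

Lemma ptraceBE (X : 'M[C]_(2 ^ n)) :
  ptraceB n m X = \sum_b adjm (embB b) *m X *m embB b.
Proof.
apply/matrixP => a a'; rewrite summxE mxE; apply: eq_bigr => b _.
by rewrite mul_embB adjm_embB_mul.
Qed.

Variable mn : (m <= n)%N.

Lemma hi_subproof (x : 'I_(2 ^ n)) : (x %/ 2 ^ m < 2 ^ (n - m))%N.
Proof. by rewrite ltn_divLR ?expn_gt0// -expnD subnK. Qed.

(* The A- and B-parts of a basis index. *)
Definition lo (x : 'I_(2 ^ n)) : 'I_(2 ^ m) := mkidx m x.
Definition hi (x : 'I_(2 ^ n)) : 'I_(2 ^ (n - m)) := Ordinal (hi_subproof x).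

Lemma eq_mkidx (x : 'I_(2 ^ n)) (a : 'I_(2 ^ m)) (b : 'I_(2 ^ (n - m))) :
  (x == mkidx n (a + 2 ^ m * b)) = (lo x == a) && (hi x == b).
Proof.
have lt : (a + 2 ^ m * b < 2 ^ n)%N.
  apply: (@leq_trans (2 ^ m * b.+1)%N); first by rewrite mulnS ltn_add2r.
  by rewrite -{2}(subnKC mn) expnD leq_mul2l ltn_ord orbT.
have m0 := exp2_gt0 m.
rewrite -!val_eqE /= (modn_small lt); apply/eqP/andP => [->|[/eqP<- /eqP<-]].
  by rewrite addnC mulnC modnMDl divnMDl// modn_small// divn_small// addn0 !eqxx.
by rewrite addnC mulnC -divn_eq.
Qed.

Lemma lo_mkidx (a : 'I_(2 ^ m)) (b : 'I_(2 ^ (n - m))) : lo (mkidx n (a + 2 ^ m * b)) = a.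
Proof. by have := eq_mkidx (mkidx n (a + 2 ^ m * b)) a b; rewrite eqxx => /esym/andP[/eqP]. Qed.

Lemma hi_mkidx (a : 'I_(2 ^ m)) (b : 'I_(2 ^ (n - m))) : hi (mkidx n (a + 2 ^ m * b)) = b.
Proof. by have := eq_mkidx (mkidx n (a + 2 ^ m * b)) a b; rewrite eqxx => /esym/andP[_ /eqP]. Qed.

Lemma lo_hi_eq x y : (x == y) = (lo x == lo y) && (hi x == hi y).
Proof.
rewrite -eq_mkidx; congr (_ == _); apply/eqP.
by rewrite eq_mkidx !eqxx.
Qed.

Lemma embB_isometry b : adjm (embB b) *m embB b = 1%:M.
Proof.
apply/matrixP => a a'; rewrite mul_embB !mxE rmorph_nat eq_mkidx.
by rewrite lo_mkidx hi_mkidx eqxx andbT eq_sym.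
Qed.

Lemma sum_embB : \sum_b embB b *m adjm (embB b) = 1%:M.
Proof.
apply/matrixP => x y; rewrite summxE.
have e b : (embB b *m adjm (embB b)) x y = (hi x == hi y)%:R * (lo x == lo y)%:R * (b == hi x)%:R.
  rewrite mxE; under eq_bigr do rewrite !mxE rmorph_nat !eq_mkidx.
  rewrite (eq_bigr (fun a => ((hi x == b) && (lo y == a) && (hi y == b))%:R * (a == lo x)%:R)).
    rewrite sum_mul_delta (eq_sym b) -natrM mulnb -natrM mulnb (eq_sym (lo y)).
    by case: eqVneq => [->|]; rewrite ?andbF //= (eq_sym (hi y)) andbT andbC.
  move=> a _; rewrite -!natrM !mulnb (eq_sym a).
  by case: (lo x == a); case: (hi x == b); case: (lo y == a); case: (hi y == b).
rewrite (eq_bigr _ (fun b _ => e b)) (sum_mul_delta (fun=> _)) -natrM mulnb andbC.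
by rewrite -lo_hi_eq mxE.
Qed.

Lemma bit_lo l (x : 'I_(2 ^ n)) : (l < m)%N -> bit l (lo x) = bit l x.
Proof.
move=> lm; apply: val_inj; rewrite /= !bitE /=; congr nat_of_bool.
rewrite {2}(divn_eq x (2 ^ m)).
have -> : (2 ^ m = 2 ^ (m - l) * 2 ^ l)%N by rewrite -expnD subnK// ltnW.
rewrite mulnA divnMDl ?expn_gt0// oddD oddM oddX /= subn_eq0 leqNgt lm /=.
by rewrite andbF.
Qed.

Lemma bit_hi l (x : 'I_(2 ^ n)) : bit l (hi x) = bit (l + m) x.
Proof. by apply: val_inj; rewrite /= !bitE /= addnC expnD divnMA. Qed.

(** The deltas at sites m, ..., n - 1 combine into equality of the B-parts; the other factors form
    the operator on A. *)
Lemma site_op_lo_hi k (s : 'M[C]_2) x y : (k < m)%N ->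
  site_op n k s x y = (hi x == hi y)%:R * site_op m k s (lo x) (lo y).
Proof.
move=> km; rewrite !mxE !bit_lo// [RHS]mulrCA; congr (_ * _).
rewrite -(big_mkord (fun l => l != k) (fun l => (bit l x == bit l y)%:R)).
rewrite (big_cat_nat (n := m)) //= mulrC; congr (_ * _).
  rewrite -prod_bits_eq -{1}[m]add0n big_addn big_mkord; apply: eq_big => [l|l _].
    by rewrite neq_ltn (leq_trans km) ?orbT ?leq_addl.
  by rewrite !bit_hi.
by rewrite big_mkord; apply: eq_bigr => l _; rewrite !bit_lo.
Qed.

Lemma site_op_embB k (s : 'M[C]_2) b : (k < m)%N ->
  site_op n k s *m embB b = embB b *m site_op m k s.
Proof.
move=> km; apply/matrixP => x a; rewrite mul_embB site_op_lo_hi// lo_mkidx hi_mkidx.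
rewrite [RHS]mxE [RHS](eq_bigr (fun c => (hi x == b)%:R * site_op m k s c a * (c == lo x)%:R)).
  by rewrite sum_mul_delta.
by move=> c _; rewrite [embB b x c]mxE eq_mkidx (eq_sym c) -mulnb natrM; ring.
Qed.

End Embedding.

(** * Expectation values and scalar estimates *)

Section Expectation.
Variable R : realType.
Local Notation C := R[i].

Lemma qform_real p (A : 'M[C]_p) (v : 'cV[C]_p) : adjm A = A ->
  (complex.Re ((adjm v *m A *m v) 0 0))%:C = (adjm v *m A *m v) 0 0.
Proof.
move=> hA; have real_entry (M : 'M[C]_1) : adjm M = M -> M 0 0 \is Num.real.
  by move=> hM; apply/CrealP; rewrite -{2}hM !mxE.
by apply/RRe_real/real_entry; rewrite !adjmM adjmK hA mulmxA.
Qed.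

Lemma qform_eigen p (A : 'M[C]_p) (v : 'cV[C]_p) (z : C) :
  adjm v *m v = 1%:M -> A *m v = z *: v -> (adjm v *m A *m v) 0 0 = z.
Proof.
by move=> v1 Av; rewrite -mulmxA Av -scalemxAr v1 !mxE eqxx mulr1.
Qed.

(** A unitary has eigenvalues of modulus 1, so the phases from v and its adjoint cancel. *)
Lemma qform_conj_unitary p (T A B : 'M[C]_p) (v : 'cV[C]_p) (t : C) :
  adjm T *m T = 1%:M -> adjm v *m v = 1%:M -> T *m v = t *: v ->
  B = T *m A *m invmx T -> adjm v *m B *m v = adjm v *m A *m v.
Proof.
move=> TT v1 Tv ->.
have Tu : T \in unitmx by case: (mulmx1_unit TT).
have tt : conjc t * t = 1.
  have : adjm (T *m v) *m (T *m v) = 1%:M.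
    by rewrite adjmM -mulmxA [adjm T *m _]mulmxA TT mul1mx v1.
  rewrite Tv adjmZ -scalemxAl -scalemxAr scalerA v1.
  by move=> /(congr1 (fun M : 'M_1 => M 0 0)); rewrite !mxE eqxx mulr1.
have -> : adjm v *m A *m v =
    adjm (T *m v) *m (T *m A *m invmx T) *m (T *m v).
  by rewrite adjmM !mulmxA mulmxKV// -[_ *m adjm T *m T]mulmxA TT mulmx1.
by rewrite Tv adjmZ -!scalemxAl -scalemxAr scalerA tt scale1r.
Qed.

Lemma conj_diag p (U A : 'M[C]_p) j :
  (adjm U *m A *m U) j j = (adjm (col j U) *m A *m col j U) 0 0.
Proof.
rewrite !mxE; apply: eq_bigr => k _; rewrite [col j U k 0]mxE; congr (_ * _).
by rewrite !mxE; apply: eq_bigr => l _; rewrite !mxE.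
Qed.

Lemma col_unit p (U : 'M[C]_p) j : adjm U *m U = 1%:M ->
  adjm (col j U) *m col j U = 1%:M.
Proof.
move=> UU; have := conj_diag U 1%:M j; rewrite !mulmx1 UU mxE eqxx => e.
by apply/matrixP => a b; rewrite !ord1 -e mxE.
Qed.

Lemma ln_cosh_le (l : R) : ln (cosh l) <= l ^+ 2 / 2.
Proof.
rewrite -[leRHS]expRK ler_ln ?posrE ?expR_gt0 ?cosh_le_expR_sqr2//.
by rewrite divr_gt0// addr_gt0 ?expR_gt0.
Qed.

Lemma cosh_gt0 (l : R) : 0 < cosh l.
Proof. by rewrite divr_gt0// addr_gt0 ?expR_gt0. Qed.

Lemma ln_mul_exprn (a b : R) j k : 0 < a -> 0 < b ->
  ln (a ^+ j * b ^+ k) = j%:R * ln a + k%:R * ln b.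
Proof.
move=> a0 b0; rewrite lnM ?posrE ?exprn_gt0//.
by rewrite (lnXn j a0) (lnXn k b0) !mulr_natl.
Qed.

End Expectation.

(** * The spin chain *)

Section Chain.
Variables (R : realType) (n : nat).
Variables (h : 'I_n -> 'I_3 -> R) (J : 'I_n -> 'I_3 -> 'I_3 -> R).
Local Notation C := R[i].

Lemma val_site_succ (i : 'I_n) :
  site_succ i = (if i.+1 == n then 0 else i.+1)%N :> nat.
Proof.
rewrite /=; case: eqP => [->|/eqP ne]; first by rewrite modnn.
by rewrite modn_small// ltn_neqAle ne ltn_ord.
Qed.

Lemma Hloc_comm (i k : 'I_n) : k != i -> k != site_succ i ->
  site_succ k != i -> site_succ k != site_succ i ->
  Hloc h J i *m Hloc h J k = Hloc h J k *m Hloc h J i.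
Proof. by move=> *; apply: comm_Hloc; exact: comm_site_Hloc. Qed.

(** The first site of one term is untouched by the other: k if k is not the successor of i, and
    otherwise i, which differs from i + 2 modulo n because n >= 3. *)
Lemma trace_Hloc_mul (i k : 'I_n) : (3 <= n)%N -> i != k ->
  \tr (Hloc h J i *m Hloc h J k) = 0.
Proof.
move=> n3 ik; have n2 := ltnW n3.
have [ks|ks] := eqVneq k (site_succ i); last first.
  by apply: trace_mul_Hloc => //; apply: comm_site_Hloc; rewrite // eq_sym.
rewrite mxtrace_mulC; apply: trace_mul_Hloc => //; apply: comm_site_Hloc => //.
apply/eqP => /(congr1 (@nat_of_ord n)); rewrite val_site_succ ks val_site_succ.
move: (ltn_ord i); do 2 case: eqP; lia.
Qed.

Lemma trace_Htot_sqr (i0 : 'I_n) : (3 <= n)%N ->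
  (forall i, \tr (Hloc h J i *m Hloc h J i) = \tr (Hloc h J i0 *m Hloc h J i0)) ->
  \tr (Htot h J *m Htot h J) = n%:R * \tr (Hloc h J i0 *m Hloc h J i0).
Proof.
move=> n3 htr; rewrite {1}/Htot mulmx_suml raddf_sum.
have diag i : \tr (Hloc h J i *m Htot h J) = \tr (Hloc h J i0 *m Hloc h J i0).
  rewrite mulmx_sumr raddf_sum (bigD1 i isT) big1 => [|k /andP[_ ki]].
    exact: etrans (addr0 _) (htr i).
  by apply: trace_Hloc_mul; rewrite // eq_sym.
rewrite (eq_bigr _ (fun i _ => diag i)).
by rewrite sumr_const card_ord mulr_natl.
Qed.

(** As i + 1 < m, the term does not wrap around and lives inside A. *)
Lemma Hloc_embB m (mn : (m <= n)%N) (i : 'I_n) b : (i.+1 < m)%N ->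
  Hloc h J i *m embB R b = embB R b *m
   (\sum_(a < 3) (h i a)%:C *: site_op m i (pauli R a)
    + \sum_(a < 3) \sum_(c < 3)
      (J i a c)%:C *: (site_op m i (pauli R a) *m site_op m i.+1 (pauli R c))).
Proof.
move=> im; rewrite /Hloc mulmxDl mulmxDr !mulmx_suml !mulmx_sumr; congr (_ + _).
  by apply: eq_bigr => a _; rewrite -scalemxAl -scalemxAr site_op_embB// ltnW.
apply: eq_bigr => a _; rewrite mulmx_suml mulmx_sumr; apply: eq_bigr => c _.
rewrite -scalemxAl -scalemxAr -mulmxA val_site_succ ifN ?neq_ltn ?(leq_trans im)//.
by rewrite site_op_embB// mulmxA site_op_embB ?mulmxA// ltnW.
Qed.

Lemma vN_entropy_le m (psi : 'cV[C]_(2 ^ n)) (e : R) :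
  (2 <= n)%N -> ~~ odd m -> (m * 2 <= n)%N ->
  (forall i, opnorm (Hloc h J i) = 1) ->
  adjm psi *m psi = 1%:M ->
  (forall i, (adjm psi *m Hloc h J i *m psi) 0 0 = e%:C) ->
  vN_entropy (ptraceB n m (psi *m adjm psi)) <= m%:R * ln 2 - m%:R * e ^+ 2 / 4.
Proof.
move=> n2 meven mn normH psi1 he.
have mn' : (m <= n)%N by lia.
pose r := m./2; have mE : m = r.*2 by rewrite even_halfK.
have n0 : (0 < n)%N by exact: ltnW.
(* The 0-based sites 0, 2, 4, ... start the disjoint pairs; the reduction modulo n has no effect for
   k < r. *)
pose st k : 'I_n := Ordinal (ltn_pmod k.*2 n0).
have stE k : (k < r)%N -> st k = k.*2 :> nat.
  by move=> kr; rewrite /= modn_small//; lia.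
pose H k := Hloc h J (st k).
have stS k : (k < r)%N -> site_succ (st k) = k.*2.+1 :> nat.
  by move=> kr; rewrite val_site_succ stE// ifN//; lia.
have neq (a b : 'I_n) : (a != b :> nat) -> a != b by apply: contraNneq => ->.
pose GA k := \sum_(a < 3) (h (st k) a)%:C *: site_op m (st k) (pauli R a)
    + \sum_(a < 3) \sum_(c < 3)
      (J (st k) a c)%:C *: (site_op m (st k) (pauli R a) *m site_op m (st k).+1 (pauli R c)).
rewrite ptraceBE.
have GV b : (e%:C *: \sum_(k < r) H k) *m embB R b = embB R b *m (e%:C *: \sum_(k < r) GA k).
  rewrite -scalemxAl -scalemxAr mulmx_suml mulmx_sumr; congr (_ *: _).
  apply: eq_bigr => k _; apply: Hloc_embB => //; rewrite stE//.
  by have := ltn_ord k; lia.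
have commH j k : (j < k < r)%N -> H j *m H k = H k *m H j.
  move=> /andP[jk kr]; have jr := ltn_trans jk kr.
  by apply: Hloc_comm; apply: neq; rewrite ?(stE, stS)//; lia.
have psdH k : (k < r)%N -> [/\ adjm (H k) = H k, psd (1%:M + H k) & psd (1%:M - H k)].
  move=> _; have hH := adjm_Hloc h J (st k) n2.
  by have [psdp psdm] := psd_opnorm1 hH (normH _); split; [exact: hH | exact: psdp | exact: psdm].
have trH k : (k < r)%N -> \tr (cosh_prod H e k *m H k) = 0.
  (* Earlier factors act on sites below 2k, so their product is trivial on site 2k. *)
  move=> kr; apply: trace_mul_Hloc => // s; apply/esym/comm_cosh_prod => j jk.
  have jr := ltn_trans jk kr.
  by apply/esym/comm_site_Hloc; apply: neq; rewrite ?(stE, stS)//; lia.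
have := vN_entropy_compress (exp2_gt0 _) (embB_isometry R mn') (sum_embB R mn')
  psi1 GV (cosh_prod_tangent e psdH commH).
move=> /le_trans; apply.
rewrite trace_cosh_prod//.
have -> : (adjm psi *m (e%:C *: (\sum_(k < r) H k)) *m psi) 0 0 = (r%:R * e ^+ 2)%:C.
  rewrite -scalemxAr -scalemxAl mxE mulmx_sumr mulmx_suml summxE.
  under eq_bigr do rewrite he.
  by rewrite sumr_const card_ord -rmorphMn -rmorphM /= -mulr_natl mulrCA expr2.
have -> : complex.Re (cosh e ^+ r * (2 ^ n)%:R)%:C / (2 ^ (n - m))%:R = cosh e ^+ r * 2 ^+ m :> R.
  rewrite /= !natrX -{1}(subnK mn') exprD; field.
  by rewrite expf_neq0 ?pnatr_eq0.
rewrite (ln_mul_exprn _ _ (cosh_gt0 e) (ltr0Sn R 1)).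
have -> : complex.Re (r%:R * e ^+ 2)%:C = r%:R * e ^+ 2 by [].
(* The energy gives - r e^2 and the trace at most r e^2 / 2; with m = 2 r the total is - m e^2 /
   4. *)
have := ler_wpM2l (ler0n R r) (ln_cosh_le e).
have -> : m%:R = r%:R * 2 :> R by rewrite mE -mul2n natrM mulrC.
by lra.
Qed.

End Chain.

Theorem theorem2 (R : realType) (n : nat) (hn : (2 <= n)%N)
  (h : 'I_n -> 'I_3 -> R) (J : 'I_n -> 'I_3 -> 'I_3 -> R)
  (Htransl : forall i : 'I_n,
     Hloc h J (site_succ i) = transl R n *m Hloc h J i *m invmx (transl R n))
  (Hnorm : forall i : 'I_n, opnorm (Hloc h J i) = 1)
  (U : 'M[R[i]]_(2 ^ n))
  (Uorth : adjm U *m U = 1%:M)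
  (Ueig : forall j : 'I_(2 ^ n),
     exists E : R[i], Htot h J *m col j U = E *: col j U)
  (Utransl : forall j : 'I_(2 ^ n),
     exists t : R[i], transl R n *m col j U = t *: col j U)
  (m : nat) (meven : ~~ odd m) (hf : (m%:R / n%:R <= 1 / 2 :> R)) :
  ((2 ^ n)%:R)^-1 *
    \sum_(j < 2 ^ n) vN_entropy (ptraceB n m (col j U *m adjm (col j U)))
  <= m%:R * ln 2 -
     (m%:R / n%:R) * expect (Hloc h J (Ordinal (ltnW hn)) *m Hloc h J (Ordinal (ltnW hn))) / 4.
Proof.
set i0 := Ordinal (ltnW hn).
have n_gt0 : 0 < n%:R :> R by rewrite ltr0n ltnW.
have d_gt0 : 0 < (2 ^ n)%:R :> R by rewrite ltr0n expn_gt0.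
have mn : (m * 2 <= n)%N.
  by rewrite -(ler_nat R) natrM; move: hf; rewrite ler_pdivrMr//; lra.
have TT := transl_unitary R n.
have Tu : transl R n \in unitmx by case: (mulmx1_unit TT).
(* Induction along the chain, to spread facts from site 0 by translation. *)
have from0 (P : 'I_n -> Prop) : P i0 -> (forall i, P i -> P (site_succ i)) -> forall i, P i.
  move=> P0 PS [k kn]; elim: k kn => [|k ih] kn.
    by rewrite (_ : Ordinal kn = i0)//; exact: val_inj.
  have -> : Ordinal kn = site_succ (Ordinal (ltnW kn)); last exact/PS/ih.
  by apply: ord_inj; rewrite val_site_succ /= ifN// neq_ltn kn.
have psi1 j := col_unit j Uorth.
pose e j := complex.Re ((adjm (col j U) *m Hloc h J i0 *m col j U) 0 0).
have he j : forall i, (adjm (col j U) *m Hloc h J i *m col j U) 0 0 = (e j)%:C.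
  apply: from0 => [|i ih]; first by rewrite qform_real// adjm_Hloc.
  have [t Tt] := Utransl j.
  have /matrixP/(_ 0 0) q := qform_conj_unitary TT (psi1 j) Tt (Htransl i).
  exact: etrans q ih.
have entropy_le j := vN_entropy_le hn meven mn Hnorm (psi1 j) (he j).
have {entropy_le} : \sum_(j < 2 ^ n) vN_entropy (ptraceB n m (col j U *m adjm (col j U)))
    <= \sum_(j < 2 ^ n) (m%:R * ln 2 - m%:R * e j ^+ 2 / 4).
  by apply: ler_sum => j _; exact: entropy_le.
rewrite sumrB sumr_const card_ord -mulr_suml -mulr_sumr => sum_le.
rewrite ler_pdivrMl//; apply: le_trans sum_le _.
rewrite -[_ *+ (2 ^ n)]mulr_natl mulrBr lerD2l lerN2.
(* Trace orthogonality needs n >= 3, since for n = 2 both bonds join the same two sites. A nonzero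
   even m <= n / 2 forces n >= 4, and m = 0 is trivial. *)
have [m0|m_neq0] := eqVneq m 0%N; first by rewrite m0 !mul0r mulr0.
have m_gt1 : (1 < m)%N by move: m_neq0 meven; case: (m) => [|[|k]].
have n3 : (3 <= n)%N by lia.
have htr : forall i, \tr (Hloc h J i *m Hloc h J i) = \tr (Hloc h J i0 *m Hloc h J i0).
  apply: from0 => [|i ih]; first exact: erefl.
  apply: etrans ih; rewrite Htransl !mulmxA mulmxKV// mxtrace_mulC.
  by rewrite !mulmxA mulVmx// mul1mx.
(* The eigenvalue is the sum of n equal local expectations, hence real and equal to n e_j. *)
have eig j : Htot h J *m col j U = (n%:R * e j)%:C *: col j U.
  have [E hE] := Ueig j; rewrite hE -(qform_eigen (psi1 j) hE) /Htot.
  rewrite mulmx_sumr mulmx_suml summxE (eq_bigr _ (fun i _ => he j i)).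
  by rewrite sumr_const card_ord rmorphM rmorph_nat mulr_natl.
have trE : \tr (Htot h J *m Htot h J) = (\sum_j (n%:R * e j) ^+ 2)%:C.
  have -> : \tr (Htot h J *m Htot h J) =
            \tr (adjm U *m (Htot h J *m Htot h J) *m U).
    by rewrite [RHS]mxtrace_mulC !mulmxA (mulmx1C Uorth) mul1mx.
  rewrite /mxtrace rmorph_sum; apply: eq_bigr => j _.
  rewrite conj_diag; apply: qform_eigen => //.
  by rewrite -mulmxA eig -scalemxAr eig scalerA -rmorphM -expr2.
have := trace_Htot_sqr n3 htr; rewrite trE => /(congr1 (@complex.Re R)).
rewrite -(rmorph_nat (real_complex R)) Re_realM /= /expect.
under eq_bigr do rewrite exprMn; rewrite -mulr_sumr expr2 => sum_sqr.
(* Cancelling one factor n leaves n times the sum of e_j^2 equal to the trace of H_1^2, so the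
   remaining inequality is an equality. *)
rewrite -mulrA in sum_sqr; have <- := mulfI (lt0r_neq0 n_gt0) sum_sqr.
rewrite le_eqVlt; apply/orP; left; apply/eqP; field.
by rewrite !gt_eqF.
Qed.
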